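(* Let $n\ge 1$ and $t\geq 18$ be integers such that $K_t^n$ has an even number of vertices (that is, $t$ is even). Then the $n$-dimensional complete grid $K_t^n$ is path-pairable.
   Context: The $n$-dimensional complete grid $K_t^n = K_t\square\cdots\square K_t$ is the Cartesian product of $n$ copies of the complete graph $K_t$: its vertex set is $\{1,\dots,t\}^n$, and two vertices are adjacent if and only if they differ in exactly one coordinate. A graph $G$ on $2k$ vertices is called path-pairable if, for any pairing of its vertices, i.e. any partition of $V(G)$ into $k$ pairs $\{x_1,y_1\},\dots,\{x_k,y_k\}$, there exist $k$ pairwise edge-disjoint paths $P_1,\dots,P_k$ in $G$ such that $P_i$ joins $x_i$ to $y_i$ for every $i=1,\dots,k$. *)

(* Defs.v *)
From mathcomp Require Import all_boot.

Set Implicit Arguments.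
Unset Strict Implicit.
Unset Printing Implicit Defensive.

Section PathPairable.

(* A graph on the finite vertex set T is given by its adjacency relation, which
   is meant to be symmetric and irreflexive. *)
Variables (T : finType) (e : rel T).

(* The path is the vertex sequence x :: s; vertices are not repeated. *)
Definition path_joins (x y : T) (s : seq T) : Prop :=
  [/\ path e x s, uniq (x :: s) & last x s = y].

(* Edges are undirected, hence two-element sets; zip truncates, so it lists the
   pairs of consecutive vertices of x :: s. *)
Definition path_edges (x : T) (s : seq T) : {set {set T}} :=
  [set [set uv.1; uv.2] | uv in zip (x :: s) s].

Definition is_pairing (k : nat) (x y : 'I_k -> T) : Prop :=
  [/\ forall i, x i != y i,
      injective (fun i => [set x i; y i])
    & partition [set [set x i; y i] | i : 'I_k] [set: T]].

Definition path_pairable : Prop :=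
  exists k : nat, #|T| = k.*2 /\
    forall x y : 'I_k -> T, is_pairing x y ->
      exists P : 'I_k -> seq T,
        (forall i, path_joins (x i) (y i) (P i)) /\
        (forall i j, i != j ->
           [disjoint path_edges (x i) (P i) & path_edges (x j) (P j)]).

End PathPairable.

(* Coordinates range over 'I_t = {0, ..., t - 1} instead of {1, ..., t}. *)
Definition grid_vertex (n t : nat) : finType := {ffun 'I_n -> 'I_t}.

Definition complete_grid (n t : nat) : rel (grid_vertex n t) :=
  fun u v => #|[set i | u i != v i]| == 1.
Arguments complete_grid : clear implicits.

Lemma complete_grid_sym n t : symmetric (complete_grid n t).
Proof.
move=> u v; rewrite /complete_grid; congr (_ == _).
by apply: eq_card => i; rewrite !inE eq_sym.
Qed.

Lemma complete_grid_irrefl n t : irreflexive (complete_grid n t).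
Proof.
move=> u; rewrite /complete_grid; apply/negbTE.
rewrite (_ : [set _ | _] = set0) ?cards0 //.
by apply/setP=> i; rewrite !inE eqxx.
Qed.

(* Main.v *)
Require Import Defs.
From mathcomp Require Import all_boot.
From mathcomp Require Import zify.

(* By induction on n one shows more: demands x i -> y i with x and y injective
   can be linked edge-disjointly in K_t^n.  In K_t x W, Koenig's theorem assigns
   to each demand a layer c i in K_t so that demands sharing the column of x, or
   the column of y, get distinct layers.  Route it within the column of x i to
   layer c i, within that layer to the column of y i, and within that column to
   y i.  Each layer then carries an injective demand system, and each column a
   demand multigraph of maximum degree 4.

   A demand multigraph of maximum degree 4 on K_t is solved as follows.  From
   each class of parallel demands one is routed directly.  The remaining demands
   form a graph of maximum degree 2 (up to multiplicities), hence of bandwidth 2.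
   Place the vertices around a circle in such an order and let each vertex
   dominate the next 7 ones.  A remaining demand ab goes through a hub c
   dominated by a and b; two such paths can only clash at a common endpoint.
   There are at least 5 common out-neighbours, and the other demands at a and b
   forbid at most 2 + 2 of them, so hubs can be chosen greedily. *)

Set Implicit Arguments.
Unset Strict Implicit.
Unset Printing Implicit Defensive.

(** * Edge colouring of bipartite multigraphs *)

(** Kempe chain argument, with demand [i] seen as an edge from [p i] to [q i]. Exchanging [a] and
    [b] on the alternating chain that starts with the [a]-edge at [v] frees [a] there, and
    bipartiteness keeps the chain away from [u]. *)
Lemma kempe_swap (I W : finType) (C : eqType) (p q : I -> W) (s : seq I)
    (c : I -> C) (u v : W) (a b : C) :
    {in s &, forall i j, p i = p j -> c i = c j -> i = j} ->
    {in s &, forall i j, q i = q j -> c i = c j -> i = j} ->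
    {in s, forall i, p i = u -> c i != a} ->
    {in s, forall i, q i = v -> c i != b} ->
  exists c' : I -> C,
    [/\ {in s &, forall i j, p i = p j -> c' i = c' j -> i = j},
        {in s &, forall i j, q i = q j -> c' i = c' j -> i = j},
        {in s, forall i, p i = u -> c' i != a} &
        {in s, forall i, q i = v -> c' i != a}].
Proof.
move=> cp cq ua vb.
case: (boolP (has (fun i => (q i == v) && (c i == a)) s)) => [|/hasPn va]; last first.
  exists c; split=> // i iS qi; apply/negP => ci.
  by have := va i iS; rewrite qi ci eqxx.
case/hasP=> f fS /andP[/eqP qf /eqP cf].
have ab : a != b by rewrite -cf; apply: vb.
(* Directing the alternating chain away from [f] keeps it off [u]: left vertices
   are entered along colour [a] only. *)
pose r := [rel g h | [&& g \in s, h \in s &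
  [&& c g == a, c h == b & p g == p h] || [&& c g == b, c h == a & q g == q h]]].
pose K := connect r f.
have KS g : K g -> g \in s.
  case/connectP=> l; elim/last_ind: l => [_ -> //|l h _].
  by rewrite rcons_path last_rcons => /andP[_ /and3P[_ hS _]] ->.
have Kc g : K g -> (c g == a) || (c g == b).
  case/connectP=> l; elim/last_ind: l => [_ ->|l h _]; first by rewrite cf eqxx.
  rewrite rcons_path last_rcons => /andP[_ /and3P[_ _ H]] ->.
  by case/orP: H => /and3P[_ -> _]; rewrite ?orbT.
have Kpred g : K g -> g = f \/ exists2 h, K h & r h g.
  case/connectP=> l; elim/last_ind: l => [_ ->|l h _]; first by left.
  rewrite rcons_path last_rcons => /andP[Hl Hr] ->; right.
  by exists (last f l) => //; apply/connectP; exists l.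
have Kbpred g : K g -> c g = b -> exists h, [/\ K h, h \in s, c h = a & p h = p g].
  move=> Kg cg; case: (Kpred _ Kg) => [gf|[h Kh /and3P[hS _ H]]].
    by move: ab; rewrite -cg gf cf eqxx.
  case/orP: H => /and3P[/eqP ch cg' /eqP E]; first by exists h.
  by move: ab; rewrite -cg (eqP cg') eqxx.
have Kapred g : K g -> c g = a ->
    g = f \/ exists h, [/\ K h, h \in s, c h = b & q h = q g].
  move=> Kg cg; case: (Kpred _ Kg) => [gf|[h Kh /and3P[hS _ H]]]; first by left.
  right; case/orP: H => /and3P[/eqP ch cg' /eqP E]; last by exists h.
  by move: ab; rewrite -cg (eqP cg') eqxx.
(* The chain contains, with an edge, every [a]- or [b]-edge sharing an end with it, so the swap
   keeps the colouring proper. Forward this is [r]; backward, the predecessor is the only edge of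
   its colour at that end. *)
have Kp g h : K g -> h \in s -> p g = p h -> c h = a \/ c h = b -> K h.
  move=> Kg hS pgh ch; have gS := KS _ Kg.
  case/orP: (Kc _ Kg) => /eqP cg; case: ch => ch.
  - by rewrite -(cp g h gS hS pgh) ?cg ?ch.
  - by apply: (connect_trans Kg); apply: connect1; rewrite /= gS hS cg ch pgh !eqxx.
  - have [h' [Kh' h'S ch' ph']] := Kbpred _ Kg cg.
    by rewrite (cp h h' hS h'S) ?ch ?ch' // -pgh ph'.
  - by rewrite -(cp g h gS hS pgh) ?cg ?ch.
have Kq g h : K g -> h \in s -> q g = q h -> c h = a \/ c h = b -> K h.
  move=> Kg hS qgh ch; have gS := KS _ Kg.
  case/orP: (Kc _ Kg) => /eqP cg; case: ch => ch.
  - by rewrite -(cq g h gS hS qgh) ?cg ?ch.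
  - case: (Kapred _ Kg cg) => [gf|[h' [Kh' h'S ch' qh']]].
      by have := vb h hS; rewrite -qgh gf qf ch eqxx => /(_ erefl).
    by rewrite (cq h h' hS h'S) ?ch ?ch' // -qgh qh'.
  - by apply: (connect_trans Kg); apply: connect1; rewrite /= gS hS cg ch qgh !eqxx orbT.
  - by rewrite -(cq g h gS hS qgh) ?cg ?ch.
pose c' i := if K i then (if c i == a then b else a) else c i.
have c'E i j : i \in s -> K i -> ~~ K j -> c' i = c' j -> c j = a \/ c j = b.
  rewrite /c' => iS Ki /negbTE-> ; rewrite Ki.
  by case: ifP => _ <-; [right|left].
have swap r' : {in s &, forall i j, r' i = r' j -> c i = c j -> i = j} ->
    (forall g h, K g -> h \in s -> r' g = r' h -> c h = a \/ c h = b -> K h) ->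
    {in s &, forall i j, r' i = r' j -> c' i = c' j -> i = j}.
  move=> cr Kr i j iS jS rij cij.
  have [Ki|nKi] := boolP (K i); have [Kj|nKj] := boolP (K j).
  - apply: cr => //; move: cij (Kc _ Ki) (Kc _ Kj); rewrite /c' Ki Kj.
    have [->|nia] := eqVneq (c i) a; have [->|nja] //= := eqVneq (c j) a.
    + by move=> E; move: ab; rewrite E eqxx.
    + by move=> E; move: ab; rewrite E eqxx.
    + by move=> _ /eqP-> /eqP->.
  - by case/negP: (nKj); apply: (Kr i) => //; apply: (c'E i).
  - by case/negP: (nKi); apply: (Kr j) => //; apply: (c'E j).
  - by apply: cr => //; move: cij; rewrite /c' (negbTE nKi) (negbTE nKj).
exists c'; split; [exact: swap|exact: swap| |].
- move=> i iS pi; rewrite /c'; case: ifP => Ki; last exact: ua.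
  case: (eqVneq (c i) a) => [ci|nci]; first by rewrite eq_sym.
  have /eqP cb : c i == b by have := Kc _ Ki; rewrite (negbTE nci).
  have [h [_ hS ch ph]] := Kbpred _ Ki cb.
  by have := ua h hS; rewrite ph ch eqxx => /(_ pi).
- move=> i iS qi; rewrite /c'; case: ifP => Ki.
    case: (eqVneq (c i) a) => [ci|nci]; first by rewrite eq_sym.
    have /eqP cb : c i == b by have := Kc _ Ki; rewrite (negbTE nci).
    by have := vb i iS qi; rewrite cb eqxx.
  apply/negP=> /eqP ci.
  by move: Ki; rewrite (cq i f) ?ci ?qi ?qf ?cf // /K connect0.
Qed.

(** The uncoloured [i] takes one of the at most [t] places at [r i], so fewer than [t] colours occur
    there. *)
Lemma missing_color (I W : finType) (t : nat) (A : {set I}) (r : I -> W)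
    (s : seq I) (c : I -> 'I_t) (i : I) :
    #|[set j in A | r j == r i]| <= t -> i \in A -> i \notin s -> {subset s <= A} ->
  exists a : 'I_t, {in s, forall j, r j = r i -> c j != a}.
Proof.
move=> deg iA iNs sA.
pose B := [set j in A | r j == r i] :\ i.
have ltB : #|c @: B| < t.
  apply: leq_ltn_trans (leq_imset_card _ _) _.
  by apply: leq_trans deg; rewrite /B (cardsD1 i [set j in A | _]) inE iA eqxx.
have [a aN|] := pickP [pred a | a \notin c @: B]; last first.
  move=> none; move: ltB; rewrite ltnNge -{1}(card_ord t) => /negP[].
  by apply: subset_leq_card; apply/subsetP => a _; have := none a => /negbFE.
exists a => j jS rj; apply: contra aN => /eqP <-; apply: imset_f.
by rewrite !inE rj eqxx sA // (memPn iNs).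
Qed.

(** Edges are coloured one by one: if [a] and [b] are missing at the two ends of the new edge,
    [kempe_swap] makes [a] missing at both. *)
Lemma konig_edge_coloring (I W : finType) (t : nat) (A : {set I}) (p q : I -> W) :
    0 < t ->
    (forall w, #|[set i in A | p i == w]| <= t) ->
    (forall w, #|[set i in A | q i == w]| <= t) ->
  exists c : I -> 'I_t,
    {in A &, forall i j, p i = p j -> c i = c j -> i = j} /\
    {in A &, forall i j, q i = q j -> c i = c j -> i = j}.
Proof.
case: t => // t _ degp degq.
suff: forall s : seq I, uniq s -> {subset s <= A} -> exists c : I -> 'I_t.+1,
    {in s &, forall i j, p i = p j -> c i = c j -> i = j} /\
    {in s &, forall i j, q i = q j -> c i = c j -> i = j}.
  move=> H; have [|i|c [cp cq]] := H (enum A); rewrite ?enum_uniq ?mem_enum //.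
  by exists c; split=> i j iA jA; [apply: cp|apply: cq]; rewrite mem_enum.
elim=> [|i s IHs] /=; first by exists (fun _ => ord0); split.
case/andP=> iNs us sub; have iA : i \in A by apply: sub; rewrite mem_head.
have sA : {subset s <= A} by move=> j js; apply: sub; rewrite inE js orbT.
have [c [cp cq]] := IHs us sA.
have [a ua] := missing_color c (degp (p i)) iA iNs sA.
have [b vb] := missing_color c (degq (q i)) iA iNs sA.
have [c' [c'p c'q c'u c'v]] := kempe_swap cp cq ua vb.
exists (fun j => if j == i then a else c' j).
have step (r : I -> W) : {in s &, forall i j, r i = r j -> c' i = c' j -> i = j} ->
    {in s, forall j, r j = r i -> c' j != a} ->
    {in i :: s &, forall j k, r j = r k ->
      (if j == i then a else c' j) = (if k == i then a else c' k) -> j = k}.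
  move=> cr ra j k; rewrite !inE.
  case: (eqVneq j i) => [->|ji]; case: (eqVneq k i) => [->|ki] //= jS kS rjk.
  - by move=> E; have := ra k kS (esym rjk); rewrite -E eqxx.
  - by move=> E; have := ra j jS rjk; rewrite -E eqxx.
  - exact: cr.
by split; apply: step.
Qed.

(** * Vertex orders of bandwidth 2 *)

(** Loops aside, the components are paths and cycles. Each is laid out from a starting vertex by
    advancing alternately along its two arms as long as both continue. *)
Lemma bandwidth2_order (V : finType) (H : rel V) :
    symmetric H -> (forall v, #|[set w | H v w]| <= 2) ->
  exists s : seq V, [/\ uniq s, forall v, v \in s
    & forall u v, H u v -> index v s <= index u s + 2].
Proof.
move=> symH deg2.
(* Grow the order at the head, so that only the last two vertices added still have
   neighbours outside. *)
pose out (s : seq V) v := [set w | H v w & w \notin s].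
have out_cons s z v : out (z :: s) v = out s v :\ z.
  by apply/setP=> w; rewrite !inE negb_or andbCA.
have out2 s v : #|out s v| <= 2.
  apply: leq_trans (deg2 v); apply: subset_leq_card.
  by apply/subsetP=> w; rewrite !inE => /andP[].
have out1 s v w : w \in s -> H v w -> #|out s v| <= 1.
  move=> ws Hvw; rewrite -ltnS; apply: leq_trans (deg2 v).
  rewrite (cardsD1 w [set w | H v w]) inE Hvw ltnS.
  apply: subset_leq_card; apply/subsetP=> z; rewrite !inE => /andP[-> zs].
  by rewrite andbT; apply: contraNneq zs => ->.
(* [q] is the newest vertex and [p] the one before. The next vertex is an outside neighbour of [p]
   if there is one, else of [q], else arbitrary. *)
pose front s := if s is q :: p :: _
  then out s p == set0 \/ (#|out s p| <= 1 /\ #|out s q| <= 1) else True.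
suff: forall m, m <= #|V| -> exists s, [/\ uniq s, size s = m,
    {in s &, forall u v, H u v -> index v s <= index u s + 2},
    {in s, forall v, 2 <= index v s -> out s v = set0} & front s].
  case/(_ _ (leqnn _)) => s [us sz bw _ _].
  have sV v : v \in s.
    have /uniq_min_size : {subset s <= enum V} by move=> w _; rewrite mem_enum.
    move=> /(_ us); rewrite -cardE sz leqnn => /(_ isT)[_ ->].
    by rewrite mem_enum.
  by exists s; split=> // u v; apply: bw.
elim=> [_|m IHm ltmV]; first by exists [::]; split.
have [s [us sz bw fin fr]] := IHm (ltnW ltmV).
(* The vertex in position 1 moves to position 2, so adding [z] must leave it without outside
   neighbours. *)
suff [z zs [third fr']] : exists2 z, z \notin s &
    (2 <= size s -> out (z :: s) (nth z s 1) = set0) /\ front (z :: s).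
  exists (z :: s); split=> //=.
  - by rewrite zs.
  - by rewrite sz.
  - have new u : u \in s -> H u z -> index u s < 2.
      move=> uS Huz; rewrite ltnNge; apply/negP=> /(fin u uS) /setP/(_ z).
      by rewrite !inE Huz zs.
    move=> u v; rewrite !inE [z == u]eq_sym [z == v]eq_sym.
    case: (eqVneq u z) => [->|uz]; case: (eqVneq v z) => [->|vz] //= uS vS Huv.
    + by rewrite add0n; apply: new; rewrite // symH.
    + exact: bw.
  - move=> v; rewrite inE [z == v]eq_sym; case: (eqVneq v z) => //= vz vS.
    rewrite ltnS leq_eqVlt => /predU1P[iv|/(fin v vS)]; last first.
      by rewrite out_cons => ->; rewrite set0D.
    have sz2 : 1 < size s by rewrite iv index_mem.
    by have := third sz2; rewrite iv nth_index.
have [w wN] : exists w, w \notin s.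
  have [w wN|none] := pickP [pred w | w \notin s]; first by exists w.
  move: ltmV; rewrite -sz ltnNge => /negP[].
  rewrite cardE; apply: uniq_leq_size (enum_uniq _) _ => w _.
  by have := none w => /negbFE.
case: s us sz bw fin fr wN => [|q s] us sz bw fin fr wN.
  by exists w => //; split.
(* The case where the second newest vertex is finished or does not exist. *)
have qcase : (2 <= size (q :: s) -> out (q :: s) (nth q s 0) = set0) ->
    exists2 z, z \notin q :: s & (2 <= size (q :: s) ->
      out (z :: q :: s) (nth z (q :: s) 1) = set0) /\ front (z :: q :: s).
  move=> p0; have nthE z : 2 <= size (q :: s) -> nth z s 0 = nth q s 0.
    by move=> ?; apply: set_nth_default.
  have pz z : 2 <= size (q :: s) -> out (z :: q :: s) (nth z (q :: s) 1) = set0.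
    by move=> lt1; rewrite /= nthE // out_cons p0 // set0D.
  have [q0|[z zq]] := set_0Vmem (out (q :: s) q).
    by exists w => //; split; [exact: pz|left; rewrite out_cons q0 set0D].
  have [Hqz zN] : H q z /\ z \notin q :: s by move: zq; rewrite inE => /andP[].
  exists z => //; split; [exact: pz|right; split].
    by rewrite out_cons -ltnS; have := out2 (q :: s) q; rewrite (cardsD1 z) zq.
  by apply: (out1 _ _ q); rewrite ?inE ?eqxx ?orbT // symH.
case: s us sz bw fin fr wN qcase => [|p s] us sz bw fin fr wN qcase; first exact: qcase.
have [p0|[z zp]] := set_0Vmem (out (q :: p :: s) p); first by apply: qcase.
have {fr}[p1 q1] : #|out (q :: p :: s) p| <= 1 /\ #|out (q :: p :: s) q| <= 1.
  by case: fr => // /eqP p0; rewrite p0 inE in zp.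
have [Hpz zN] : H p z /\ z \notin q :: p :: s by move: zp; rewrite inE => /andP[].
(* [z] was the last outside neighbour of [p]; as [p] is already placed, [z] itself has at most one
   left outside. *)
exists z => //; split.
  move=> _; apply/eqP; rewrite -cards_eq0 out_cons -leqn0 -ltnS.
  by apply: leq_trans p1; rewrite [leqRHS](cardsD1 z) zp.
right; split; first by rewrite out_cons (leq_trans _ q1) // subset_leq_card // subD1set.
by apply: (out1 _ _ p); rewrite ?inE ?eqxx ?orbT // symH.
Qed.

(** * Edge-disjoint linking in complete graphs *)

(* The colour classes of [g] carry the walks, so edge-disjointness is built in;
   only the values of [g] on edges matter. *)
Definition linked (T I : finType) (e : rel T) (A : {set I}) (x y : I -> T) : Prop :=
  exists g : T -> T -> option I,
    (forall u v, g u v = g v u) /\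
    {in A, forall i, connect [rel u v | e u v && (g u v == Some i)] (x i) (y i)}.

(** Two steps of length at most 7 advance by at most 14 positions, less than a full turn, so no two
    vertices dominate each other. *)
Lemma circular_tournament (V : finType) (H : rel V) :
    14 < #|V| -> symmetric H -> (forall v, #|[set w | H v w]| <= 2) ->
  exists out : rel V, (forall u v, out u v -> ~~ out v u) /\
    forall u v, H u v -> 5 <= #|[set w | out u w && out v w]|.
Proof.
move=> ltV symH deg2; have [s [us sV bw]] := bandwidth2_order symH deg2.
have sz : size s = #|V|.
  rewrite cardE; apply/perm_size/uniq_perm; rewrite ?enum_uniq // => v.
  by rewrite mem_enum sV.
have lts v : index v s < #|V| by rewrite -sz index_mem.
pose out := [rel u w | [exists d : 'I_7, index w s == (index u s + d.+1) %% #|V|]].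
exists out; split=> [u v /existsP[d /eqP dE]|u v].
  apply/negP=> /existsP[d' /eqP d'E].
  move: (ltn_ord d) (ltn_ord d') (lts u) (lts v) => ltd ltd' ltu ltv.
  move: d'E; rewrite dE modnDml => E.
  have : index u s + (d.+1 + d'.+1) = index u s %[mod #|V|].
    by rewrite addnA -E modn_small.
  move/eqP; rewrite -{2}[index u s]addn0 eqn_modDl mod0n modn_small; lia.
wlog le_uv : u v / index u s <= index v s => [IH Huv|Huv].
  case: (leqP (index u s) (index v s)) => [|/ltnW] le; first exact: IH.
  have := IH v u le; rewrite symH => /(_ Huv).
  move/leq_trans; apply; apply: subset_leq_card.
  by apply/subsetP=> w; rewrite !inE andbC.
have le2 : index v s <= index u s + 2 by apply: bw.
(* The five vertices following [v] lie at distance at most 2 + 5 = 7 from [u], hence are dominated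
   by both. *)
pose h (j : 'I_5) := nth u s ((index v s + j.+1) %% #|V|).
have ltm j : (index v s + j) %% #|V| < size s by rewrite sz ltn_mod; lia.
have hI : injective h.
  move=> j k /eqP; rewrite nth_uniq // eqn_modDl => /eqP E; apply: ord_inj.
  by have [? ?] := (ltn_ord j, ltn_ord k); move: E; rewrite !modn_small; lia.
rewrite -(card_ord 5) -(card_imset _ hI); apply: subset_leq_card.
apply/subsetP=> _ /imsetP[j _ ->]; rewrite inE; have lt5 := ltn_ord j.
have ltd : index v s - index u s + j < 7 by lia.
have ltd' : j < 7 by lia.
apply/andP; split; apply/existsP; [exists (Ordinal ltd)|exists (Ordinal ltd')];
  rewrite /h index_uniq //=; apply/eqP; congr (_ %% _); lia.
Qed.

Lemma set2_inj (V : finType) (u v w : V) : [set u; v] = [set u; w] -> v = w.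
Proof.
move=> E; have: v \in [set u; w] by rewrite -E !inE eqxx orbT.
have: w \in [set u; v] by rewrite E !inE eqxx orbT.
by rewrite !inE => /orP[]/eqP-> // /orP[]/eqP.
Qed.

(** [dir] reserves an edge for one demand of each parallel class; [excess] holds the demands that
    need a hub. Since [out] orients every spoke towards its hub, two spokes on the same edge share
    both endpoint and hub, which [minj] excludes. *)
Lemma complete_linked (V I : finType) (x y : I -> V) :
    14 < #|V| ->
    (forall v, #|[set i | x i != y i & v \in [set x i; y i]]| <= 4) ->
  linked [rel u v | u != v] [set: I] x y.
Proof.
move=> ltV deg4.
pose ends i := [set x i; y i].
pose inc v := [set i | x i != y i & v \in ends i].
pose dir (u v : V) := [pick i | (x i != y i) && (ends i == [set u; v])].
pose excess := [set i | (x i != y i) && (dir (x i) (y i) != Some i)].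
have dirC u v : dir u v = dir v u by rewrite /dir setUC.
have dirP u v i : dir u v = Some i -> x i != y i /\ ends i = [set u; v].
  by rewrite /dir; case: pickP => // j /andP[nj /eqP ej] [<-].
have dir_ends i u v : ends i = [set u; v] -> dir u v = dir (x i) (y i).
  by rewrite /dir => <-.
have dirE i : x i != y i -> exists j, dir (x i) (y i) = Some j.
  move=> ni; rewrite /dir; case: pickP => [j _|/(_ i)]; first by exists j.
  by rewrite ni eqxx.
pose H := [rel u v | [exists i in excess, ends i == [set u; v]]].
have symH : symmetric H by move=> u v; rewrite /H /= setUC.
pose other v i := if x i == v then y i else x i.
have otherE i v w : ends i = [set v; w] -> other v i = w.
  rewrite /other /ends => E; case: eqVneq => [xv|nxv].
    by apply: (@set2_inj _ v); rewrite -E xv.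
  have: x i \in [set v; w] by rewrite -E !inE eqxx.
  by rewrite !inE (negbTE nxv) => /eqP.
have dir_direct i u v : dir u v = Some i -> i \notin excess.
  by move=> /[dup] /dirP[_ /dir_ends->] di; rewrite inE -di eqxx andbF.
(* Each neighbour in [H] accounts for two demands, an excess one and a direct one. *)
have deg2 v : #|[set w | H v w]| <= 2.
  set N := [set w | H v w].
  have [N1 N2] : N \subset other v @: (inc v :&: excess) /\
                 N \subset other v @: (inc v :\: excess).
    split; apply/subsetP=> w; rewrite inE => /exists_inP[i iX /eqP ei].
      apply/imsetP; exists i; last by rewrite (otherE _ _ w).
      have vi : v \in ends i by rewrite ei !inE eqxx.
      by rewrite in_setI iX inE vi; move: iX; rewrite inE => /andP[->].
    have ni : x i != y i by move: iX; rewrite inE => /andP[].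
    have [j dj] := dirE i ni; have [nj ej] := dirP _ _ _ dj.
    have {}ej : ends j = [set v; w] by rewrite ej -ei.
    have vj : v \in ends j by rewrite ej !inE eqxx.
    apply/imsetP; exists j; last by rewrite (otherE _ _ w).
    by rewrite in_setD (dir_direct _ _ _ dj) inE nj vj.
  have le1 := leq_trans (subset_leq_card N1) (leq_imset_card _ _).
  have le2 := leq_trans (subset_leq_card N2) (leq_imset_card _ _).
  have := deg4 v; rewrite -/(ends _) -/(inc v) -(cardsID excess); lia.
have [out [out_anti out5]] := circular_tournament ltV symH deg2.
have out_irr v : out v v = false.
  by apply/negP=> /[dup] /out_anti /negP.
have [m [mspoke minj]] : exists m : I -> V,
    (forall i v, i \in excess -> v \in ends i -> out v (m i) /\ dir v (m i) = None) /\
    (forall i j v, i \in excess -> j \in excess -> v \in ends i -> v \in ends j ->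
      m i = m j -> i = j).
  suff: forall s : seq I, uniq s -> {subset s <= excess} -> exists m : I -> V,
      (forall i v, i \in s -> v \in ends i -> out v (m i) /\ dir v (m i) = None) /\
      (forall i j v, i \in s -> j \in s -> v \in ends i -> v \in ends j ->
        m i = m j -> i = j).
    case/(_ (enum excess) (enum_uniq _)) => [i|m [m1 m2]]; first by rewrite mem_enum.
    exists m; split=> [i v iX|i j v iX jX]; first by apply: m1; rewrite mem_enum.
    by apply: m2; rewrite mem_enum.
  elim=> [|i s IHs] /=; first by exists x; split.
  case/andP=> iNs us sub; have iX : i \in excess by apply: sub; rewrite mem_head.
  have sX : {subset s <= excess} by move=> j js; apply: sub; rewrite inE js orbT.
  have [m [m1 m2]] := IHs us sX.
  have ni : x i != y i by move: iX; rewrite inE => /andP[].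
  have [d dd] := dirE i ni; have [nd ed] := dirP _ _ _ dd.
  have dNX := dir_direct _ _ _ dd.
  (* Hubs forbidden at [v]: those of other excess demands and the far ends of direct ones. Demands
     not yet treated contribute a harmless arbitrary value. The direct demand [d] parallel to [i]
     may be dropped, since its far end is an end of [i] and does not dominate itself; this leaves 4
     - 2 = 2. *)
  pose used v := (fun j => if j \in excess then m j else other v j) @: (inc v :\ i :\ d).
  have card_used v : v \in ends i -> #|used v| <= 2.
    move=> vi; apply: leq_trans (leq_imset_card _ _) _.
    have iinc : i \in inc v by rewrite inE ni.
    have dinc : d \in inc v :\ i.
      have di : d != i by apply: contraNneq dNX => ->.
      have vd : v \in ends d by rewrite ed.
      by rewrite in_setD1 di inE nd vd.
    have := deg4 v; rewrite -/(ends _) -/(inc v) (cardsD1 i) iinc (cardsD1 d) dinc; lia.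
  have Hxy : H (x i) (y i) by apply/exists_inP; exists i.
  have [c cL cN] : exists2 c, c \in [set w | out (x i) w && out (y i) w] &
      c \notin used (x i) :|: used (y i).
    apply/subsetPn; apply/negP=> /subset_leq_card.
    have xi : x i \in ends i by rewrite !inE eqxx.
    have yi : y i \in ends i by rewrite !inE eqxx orbT.
    move: (out5 _ _ Hxy) (card_used _ xi) (card_used _ yi).
    rewrite cardsU; lia.
  have outc v : v \in ends i -> out v c.
    by move: cL; rewrite !inE => /andP[? ?] /orP[]/eqP->.
  have cNends : c \notin ends i by apply/negP=> /outc; rewrite out_irr.
  have cNused v : v \in ends i -> c \notin used v.
    by move: cN; rewrite in_setU negb_or !inE => /andP[? ?] /orP[]/eqP->.
  have usedP v j : j \in inc v -> j != i -> j != d ->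
      (if j \in excess then m j else other v j) \in used v.
    by move=> jv ji jd; apply: (imset_f (fun j => _)); rewrite !in_setD1 ji jd.
  have new j v : j \in s -> v \in ends i -> v \in ends j -> m j != c.
    move=> js vi vj; apply: contraNneq (cNused v vi) => <-.
    have jX := sX _ js; have := usedP v j; rewrite jX; apply.
    - by rewrite inE; move: jX; rewrite inE vj => /andP[->].
    - by apply: contraNneq iNs => <-.
    - by apply: contraNneq dNX => <-.
  exists (fun j => if j == i then c else m j); split=> [j v|j k v]; rewrite !in_cons.
    case: eqP => [->|_] //=; last exact: m1.
    move=> _ vi; split; first exact: outc.
    case dj: (dir v c) => [j0|] //; have [nj ej] := dirP _ _ _ dj.
    case/negP: (cNused v vi); have jNX := dir_direct _ _ _ dj.
    have := usedP v j0; rewrite (negbTE jNX) (otherE _ _ _ ej); apply.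
    - by rewrite inE nj ej !inE eqxx.
    - by apply: contraNneq jNX => ->.
    - by apply: contraNneq cNends => jd; rewrite /ends -ed -jd ej !inE eqxx orbT.
  case: (eqVneq j i) => [->|ji]; case: (eqVneq k i) => [->|ki] //= js ks vj vk.
  - by move=> E; case/eqP: (new k v ks vj vk).
  - by move=> E; case/eqP: (new j v js vk vj).
  - exact: m2 vj vk.
pose hub u c := [pick i in excess | (m i == c) && (u \in ends i)].
(* Direct demands take precedence, and [mspoke] keeps spokes off their edges. The orientation tells
   which end is the hub, so [g] is symmetric. *)
pose g u v := if dir u v is Some i then Some i
  else if out u v then hub u v else if out v u then hub v u else None.
have gC u v : g u v = g v u.
  rewrite /g dirC; case: (dir v u) => //.
  have := out_anti u v; case: (out u v); case: (out v u) => // H0.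
  by have := H0 isT.
have g_spoke i v : i \in excess -> v \in ends i -> (v != m i) && (g v (m i) == Some i).
  move=> iX vi; have [ov dv] := mspoke i v iX vi.
  apply/andP; split; first by apply: contraTneq ov => <-; rewrite out_irr.
  rewrite /g dv ov /hub; case: pickP => [j|/(_ i)]; last by rewrite iX eqxx vi.
  by case/and3P=> jX /eqP mj vj; rewrite (minj j i v).
exists g; split=> // i _.
have [->|ni] := eqVneq (x i) (y i); first exact: connect0.
have [iX|iD] := boolP (i \in excess).
  have xi : x i \in ends i by rewrite !inE eqxx.
  have yi : y i \in ends i by rewrite !inE eqxx orbT.
  apply: (@connect_trans _ _ (m i)); apply: connect1; first exact: g_spoke.
  by rewrite /= gC eq_sym; apply: g_spoke.
apply: connect1; rewrite /= ni /g; move: iD; rewrite inE ni /= negbK => /eqP->.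
by rewrite eqxx.
Qed.

(** * Cartesian products *)

(** Unlike pairings, this passes to the layers of a product, where a vertex may be the source of one
    demand and the target of another. *)
Definition injection_linked (T : finType) (e : rel T) : Prop :=
  forall (I : finType) (A : {set I}) (x y : I -> T),
    {in A &, injective x} -> {in A &, injective y} -> linked e A x y.

Definition box (T W : finType) (e : rel T) (f : rel W) : rel (T * W) :=
  [rel u v | (u.2 == v.2) && e u.1 v.1 || (u.1 == v.1) && f u.2 v.2].

Lemma connect_map (T T' : finType) (e : rel T) (e' : rel T') (h : T -> T') (u v : T) :
  (forall a b, e a b -> e' (h a) (h b)) -> connect e u v -> connect e' (h u) (h v).
Proof.
move=> he /connectP[s sP ->]; elim: s u sP => [|a s IHs] u /=; first by rewrite connect0.
by case/andP=> /he ua /IHs; apply: connect_trans (connect1 ua).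
Qed.

(** A column has [t] vertices, so at most [t] demands start in it and at most [t] end in it: one
    colour per layer suffices. *)
Lemma injection_linked_box (t : nat) (W : finType) (f : rel W) :
    14 < t -> symmetric f -> irreflexive f -> injection_linked f ->
  injection_linked (box [rel a b : 'I_t | a != b] f).
Proof.
move=> ltt f_sym f_irr Wlinked I A x y xI yI.
have fibre (r : I -> 'I_t * W) w : {in A &, injective r} ->
    #|[set i in A | (r i).2 == w]| <= t.
  move=> rI; rewrite -[leqRHS]card_ord.
  rewrite -(@card_in_imset _ _ (fun i => (r i).1)) ?max_card // => i j.
  rewrite !inE => /andP[iA /eqP iw] /andP[jA /eqP jw] E; apply: rI => //.
  by rewrite [r i]surjective_pairing [r j]surjective_pairing E iw jw.
have [//|||c [cx cy]] := @konig_edge_coloring I W t A (snd \o x) (snd \o y).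
- by lia.
- by move=> w; apply: fibre.
- by move=> w; apply: fibre.
have /fin_all_exists[gl glP] (k : 'I_t) :
    exists g : W -> W -> option I, (forall u v, g u v = g v u) /\
    {in [set i in A | c i == k], forall i,
      connect [rel u v | f u v && (g u v == Some i)] (x i).2 (y i).2}.
  by apply: Wlinked => i j; rewrite !inE => /andP[iA /eqP ik] /andP[jA /eqP jk] E;
    [apply: cx|apply: cy]; rewrite // ik jk.
(* A demand which does not enter or leave column [w] is turned into a loop there. *)
pose X w (d : I + I) := match d with
  | inl i => if (i \in A) && ((x i).2 == w) then (x i).1 else c i
  | inr i => if (i \in A) && ((y i).2 == w) then (y i).1 else c i end.
pose Y (d : I + I) := match d with inl i => c i | inr i => c i end.
(* [inl i] and [inr i] are the legs of [i] in the columns of its source and its target; they are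
   separate demands because both columns may be the same. *)
have /fin_all_exists[gc gcP] (w : W) :
    exists g : 'I_t -> 'I_t -> option (I + I), (forall u v, g u v = g v u) /\
    {in [set: I + I], forall d,
      connect [rel u v | (u != v) && (g u v == Some d)] (X w d) (Y d)}.
  apply: complete_linked => [|v]; first by rewrite card_ord.
  (* The degree 4 at [v] comes from at most one demand starting there, one ending there ([B]), one
     leaving into layer [v] and one coming back from it ([C]). *)
  pose B (r : I -> 'I_t * W) := [set i in A | r i == (v, w)].
  pose C (r : I -> 'I_t * W) := [set i in A | ((r i).2 == w) && (c i == v)].
  have cardB r : {in A &, injective r} -> #|B r| <= 1.
    move=> rI; apply/card_le1_eqP => i j; rewrite !inE.
    by move=> /andP[iA /eqP ri] /andP[jA /eqP rj]; apply: rI; rewrite // ri rj.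
  have cardC r : {in A &, forall i j, (r i).2 = (r j).2 -> c i = c j -> i = j} ->
      #|C r| <= 1.
    move=> rI; apply/card_le1_eqP => i j; rewrite !inE.
    move=> /and3P[iA /eqP ri /eqP ci] /and3P[jA /eqP rj /eqP cj].
    by apply: rI; rewrite // ?ri ?rj ?ci ?cj.
  have sub : [set d | X w d != Y d & v \in [set X w d; Y d]] \subset
      (inl @: B x :|: inl @: C x) :|: (inr @: B y :|: inr @: C y).
    apply/subsetP=> -[i|i]; rewrite !inE /=; case: ifP; rewrite ?eqxx //.
      case/andP=> iA xw /andP[_ /orP[/eqP vx|/eqP vc]]; apply/orP; left; apply/orP.
        left; apply: imset_f; rewrite inE iA /= [x i]surjective_pairing -vx.
        by rewrite (eqP xw).
      by right; apply: imset_f; rewrite inE iA xw -vc eqxx.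
    case/andP=> iA yw /andP[_ /orP[/eqP vy|/eqP vc]]; apply/orP; right; apply/orP.
      left; apply: imset_f; rewrite inE iA /= [y i]surjective_pairing -vy.
      by rewrite (eqP yw).
    by right; apply: imset_f; rewrite inE iA yw -vc eqxx.
  apply: leq_trans (subset_leq_card sub) _.
  have im (h : I -> I + I) (D : {set I}) : #|D| <= 1 -> #|h @: D| <= 1.
    exact: leq_trans (leq_imset_card _ _).
  move: (im inl _ (cardB _ xI)) (im inl _ (cardC _ cx)).
  move: (im inr _ (cardB _ yI)) (im inr _ (cardC _ cy)).
  rewrite !cardsU; lia.
(* The two legs of a demand may share its colour, as only edges of different demands must differ. *)
pose strip (o : option (I + I)) :=
  match o with Some (inl i) => Some i | Some (inr i) => Some i | None => None end.
pose g (u v : 'I_t * W) :=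
  if u.2 == v.2 then strip (gc u.2 u.1 v.1)
  else if u.1 == v.1 then gl u.1 u.2 v.2 else None.
have gC u v : g u v = g v u.
  rewrite /g eq_sym; case: eqP => [->|_]; first by rewrite (gcP _).1.
  by rewrite eq_sym; case: eqP => // ->; rewrite (glP _).1.
exists g; split=> // i iA.
have col w d i' : strip (Some d) = Some i' ->
    connect [rel u v | box [rel a b : 'I_t | a != b] f u v && (g u v == Some i')]
      (X w d, w) (Y d, w).
  move=> di; apply: (connect_map (h := fun a => (a, w))) ((gcP w).2 d (in_setT _)) => a b.
  by case/andP=> /= ab /eqP E; rewrite /g /box /= eqxx ab E di eqxx.
have layer : connect [rel u v | box [rel a b : 'I_t | a != b] f u v && (g u v == Some i)]
    (c i, (x i).2) (c i, (y i).2).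
  have iAk : i \in [set j in A | c j == c i] by rewrite inE iA eqxx.
  apply: (connect_map (h := fun w => (c i, w))) ((glP (c i)).2 i iAk) => a b.
  case/andP=> /= ab /eqP E; have nab : a != b by apply: contraTneq ab => ->; rewrite f_irr.
  by rewrite /g /box /= eqxx ab orbT (negbTE nab) E eqxx.
have first_leg := col (x i).2 (inl i) i erefl.
have last_leg := col (y i).2 (inr i) i erefl.
rewrite /= iA eqxx /= -surjective_pairing in first_leg.
rewrite /= iA eqxx /= -surjective_pairing in last_leg.
apply: connect_trans first_leg (connect_trans layer _).
(* The last leg was built from [y i] towards its layer and is traversed backwards. *)
rewrite sym_connect_sym // => u v.
by rewrite /= gC /box /= ![_ == u.2]eq_sym ![_ == u.1]eq_sym f_sym.
Qed.

(** * Grids and path-pairability *)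

Lemma injection_linked_transfer (T T' : finType) (e : rel T) (e' : rel T') (h : T -> T') :
    bijective h -> (forall a b, e a b -> e' (h a) (h b)) ->
  injection_linked e -> injection_linked e'.
Proof.
case=> h' hK h'K he eL I A x y xI yI.
have comp (z : I -> T') : {in A &, injective z} -> {in A &, injective (h' \o z)}.
  by move=> zI i j iA jA /(can_inj h'K); apply: zI.
have [g [gC gP]] := eL I A _ _ (comp x xI) (comp y yI).
exists (fun u v => g (h' u) (h' v)); split=> [u v|i iA]; first exact: gC.
rewrite -[x i]h'K -[y i]h'K; apply: (connect_map (h := h)) (gP i iA) => a b /=.
by case/andP=> /he-> /eqP gi; rewrite !hK gi eqxx.
Qed.

Lemma grid_injection_linked (n t : nat) :
  14 < t -> injection_linked (complete_grid n t).
Proof.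
move=> ltt; elim: n => [|n IHn].
  move=> I A x y _ _; exists (fun _ _ => None); split=> // i _.
  by rewrite (_ : y i = x i) ?connect0 //; apply/ffunP; case.
(* Splitting off coordinate [ord0] identifies the grid with the product of [K_t] and the grid of
   dimension [n]. *)
pose h (u : 'I_t * grid_vertex n t) : grid_vertex n.+1 t :=
  [ffun i => if unlift ord0 i is Some j then u.2 j else u.1].
pose h' (u : grid_vertex n.+1 t) : 'I_t * grid_vertex n t :=
  (u ord0, [ffun j => u (lift ord0 j)]).
have hK : cancel h h'.
  case=> a w; rewrite /h /h' ffunE unlift_none; congr (_, _).
  by apply/ffunP => j; rewrite !ffunE liftK.
have h'K : cancel h' h.
  by move=> u; apply/ffunP => i; rewrite !ffunE; case: unliftP => [j ->|->] /=; rewrite ?ffunE.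
have := injection_linked_box ltt (@complete_grid_sym n t) (@complete_grid_irrefl n t) IHn.
apply: (@injection_linked_transfer _ _ _ _ h); first by exists h'.
move=> [a w] [b v] /=; rewrite /complete_grid /box /=.
have -> : [set i | h (a, w) i != h (b, v) i] =
    (if a != b then [set ord0] else set0) :|: lift ord0 @: [set i | w i != v i].
  apply/setP=> i; rewrite !inE !ffunE /=; case: unliftP => [j ->|->].
    have -> : (lift ord0 j \in if a != b then [set ord0] else set0) = false.
      by case: ifP; rewrite !inE // eq_sym (negbTE (neq_lift _ _)).
    by rewrite mem_imset ?inE //; apply: lift_inj.
  rewrite [X in _ || X](_ : _ = false) ?orbF; last first.
    by apply/imsetP => -[j _ /eqP]; rewrite (negbTE (neq_lift _ _)).
  by case: ifP => /= E; rewrite !inE.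
case/orP=> /andP[/eqP->].
  move=> ->; rewrite (_ : [set i | v i != v i] = set0); last first.
    by apply/setP=> i; rewrite !inE eqxx.
  by rewrite imset0 setU0 cards1.
by rewrite eqxx set0U card_imset //; apply: lift_inj.
Qed.

(** Disjointness of the pairs makes both endpoint maps injective. Walks inside a colour class are
    shortened to paths, and symmetry of [g] lets the colour be read off the unordered edge. *)
Lemma path_pairable_of_injection_linked (T : finType) (e : rel T) :
  ~~ odd #|T| -> injection_linked e -> path_pairable e.
Proof.
move=> Teven eL; exists #|T|./2; split; first by rewrite even_halfK.
move=> x y [xNy pI /and3P[_ /trivIsetP triv _]].
have same i j z : z \in [set x i; y i] -> z \in [set x j; y j] -> i = j.
  move=> zi zj; apply: pI; apply/eqP; apply: contraT => nij.
  have dij : [disjoint [set x i; y i] & [set x j; y j]].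
    by apply: triv nij; apply: imset_f.
  by have := disjointFr dij zi; rewrite zj.
have xI : {in [set: 'I_#|T|./2] &, injective x}.
  by move=> i j _ _ E; apply: (same i j (x i)); rewrite !inE ?E eqxx.
have yI : {in [set: 'I_#|T|./2] &, injective y}.
  by move=> i j _ _ E; apply: (same i j (y i)); rewrite !inE ?E eqxx orbT.
have [g [gC gP]] := eL _ _ _ _ xI yI.
pose r i := [rel u v | e u v && (g u v == Some i)].
have /fin_all_exists[P PP] i : exists s : seq T, path_joins (r i) (x i) (y i) s.
  have /connectP[s sP ->] := gP i (in_setT i).
  by case/shortenP: sP => s' s'P us' _; exists s'.
exists P; split=> [i|i j nij].
  case: (PP i) => pi ui li; split=> //; apply: sub_path pi => u v.
  by case/andP.
have edgeP k E : E \in path_edges (x k) (P k) ->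
    exists u v, E = [set u; v] /\ g u v = Some k.
  case/imsetP=> -[u v] uvP ->; exists u, v; split=> //.
  case: (PP k) => pk _ _; move: (P k) (x k) pk uvP.
  elim=> [|b s IHs] a //= /andP[/andP[_ /eqP gab] pb].
  by rewrite inE => /predU1P[[-> ->] //|]; apply: IHs.
rewrite disjoint_subset; apply/subsetP=> E /edgeP[u [v [-> gi]]].
rewrite inE; apply/negP=> /edgeP[u' [v' [E' gj]]].
suff gg : g u v = g u' v' by case/eqP: nij; move: gi; rewrite gg gj => -[].
have : u \in [set u'; v'] by rewrite -E' !inE eqxx.
rewrite !inE => /orP[]/eqP uE; rewrite uE in E' *.
  by rewrite (set2_inj E').
by rewrite gC (set2_inj (w := u') (v := v) (u := v')) // E' setUC.
Qed.

Theorem corollary2 (n t : nat) (hn : 1 <= n) (ht : 18 <= t)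
    (heven : ~~ odd #|grid_vertex n t|) :
  path_pairable (complete_grid n t).
Proof.
apply: path_pairable_of_injection_linked; first exact: heven.
by apply: grid_injection_linked; apply: leq_trans ht.
Qed.
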